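(* Let $G=([n],E)$ be a graph, let $x\in\Delta_n$ with support $S=\{i\in[n]:x_i\ne0\}$, and let $C_1,\dots,C_k$ denote the connected components (vertex sets) of the induced subgraph $G[S]$. Then $x$ is a global minimizer of the problem $$\min\{y^T(A_G+I)y:y\in\Delta_n\}$$ if and only if the following conditions hold: (i) $k=\alpha(G)$, (ii) $C_h$ is a clique of $G$ for all $h\in[k]$, (iii) $\sum_{i\in C_h}x_i=1/k$ for all $h\in[k]$.
   Context: Graphs are finite and simple. $\Delta_n=\{x\in\mathbb{R}^n:x\ge0,\sum_{i=1}^nx_i=1\}$, $A_G$ is the adjacency matrix of $G$, $I$ the identity matrix, and $\alpha(G)$ the maximum cardinality of a stable set of $G$. A clique is a set of vertices any two distinct elements of which are adjacent. (By Motzkin–Straus, the minimum value of the problem is $1/\alpha(G)$.) *)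

(* Defs.v *)
From mathcomp Require Import all_boot all_order all_algebra.
From mathcomp Require Import reals.

Set Implicit Arguments.
Unset Strict Implicit.
Unset Printing Implicit Defensive.

Import Order.TTheory GRing.Theory Num.Theory.
Local Open Scope ring_scope.

(* A finite simple graph on the vertex set T is a symmetric and irreflexive
   relation [e : rel T]; the two properties are assumed where needed. *)

Definition stable_set (T : finType) (e : rel T) (A : {set T}) : bool :=
  [forall i in A, forall j in A, ~~ e i j].

Definition stability_number (T : finType) (e : rel T) : nat :=
  \max_(A : {set T} | stable_set e A) #|A|.

Definition clique (T : finType) (e : rel T) (A : {set T}) : bool :=
  [forall i in A, forall j in A, (i != j) ==> e i j].

(* The edge relation of the induced subgraph e[S], kept on the ambient type T:
   vertices outside S are isolated. *)
Definition induced (T : finType) (e : rel T) (S : {set T}) : rel T :=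
  [rel i j | [&& i \in S, j \in S & e i j]].

(* The vertex sets of the connected components of e[S]: the classes in S of
   the relation "joined by a path of e[S]". *)
Definition components (T : finType) (e : rel T) (S : {set T}) :
    {set {set T}} :=
  equivalence_partition (connect (induced e S)) S.

Definition adjacency (R : realType) (n : nat) (e : rel 'I_n) : 'M[R]_n :=
  \matrix_(i, j) (e i j)%:R.

Definition simplex (R : realType) (n : nat) (y : 'cV[R]_n) : Prop :=
  (forall i, 0 <= y i 0) /\ \sum_i y i 0 = 1.

Definition supp (R : realType) (n : nat) (y : 'cV[R]_n) : {set 'I_n} :=
  [set i | y i 0 != 0].

(* The entry at (0, 0) is the value of the 1 x 1 matrix y^T M y. *)
Definition quad_form (R : realType) (n : nat) (M : 'M[R]_n) (y : 'cV[R]_n) :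
    R :=
  (y^T *m M *m y) 0 0.

Definition global_minimizer (R : realType) (T : Type) (feasible : T -> Prop)
    (f : T -> R) (x : T) : Prop :=
  feasible x /\ forall y, feasible y -> f x <= f y.

(* Main.v *)
(** A stable set of maximum size yields the value [1 / alpha], and shifting the
    mass of one end of an edge inside the support onto the other end never
    increases the form if the end is well chosen; iterating makes the support
    stable, so [1 / alpha] is the minimum (Motzkin-Straus).  If the support of
    a minimizer induced a path [i - j - l], then along
    [d = e_i + e_l - 2 e_j] the form would be strictly concave, [q(d) = -2],
    and [x + t d] or [x - t d] would be better.  So the components of [G[S]]
    are cliques, and then [q(x) = sum_h x(C_h)^2 = 1/k + sum_h (x(C_h) - 1/k)^2]
    while picking one vertex per component shows [k <= alpha]. *)

Require Import Defs.
From mathcomp Require Import all_boot all_order all_algebra.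
From mathcomp Require Import reals.
From mathcomp Require Import ring lra.

Set Implicit Arguments.
Unset Strict Implicit.
Unset Printing Implicit Defensive.

Import Order.TTheory GRing.Theory Num.Theory.
Local Open Scope ring_scope.

(** * The bilinear form of a matrix *)

Section BilinearForm.
Variables (R : comNzRingType) (n : nat) (M : 'M[R]_n).

(** Polar companion of [quad_form]: the two agree by conversion when [y] and [z] coincide, so moving
    along a direction becomes bilinear algebra. *)
Definition bilin (y z : 'cV[R]_n) : R := (y^T *m M *m z) 0 0.

Lemma bilinDl y1 y2 z : bilin (y1 + y2) z = bilin y1 z + bilin y2 z.
Proof. by rewrite /bilin linearD /= !mulmxDl mxE. Qed.

Lemma bilinDr y z1 z2 : bilin y (z1 + z2) = bilin y z1 + bilin y z2.
Proof. by rewrite /bilin mulmxDr mxE. Qed.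

Lemma bilinZl a y z : bilin (a *: y) z = a * bilin y z.
Proof. by rewrite /bilin linearZ /= -!scalemxAl mxE. Qed.

Lemma bilinZr a y z : bilin y (a *: z) = a * bilin y z.
Proof. by rewrite /bilin -scalemxAr mxE. Qed.

Lemma bilinC y z : M^T = M -> bilin y z = bilin z y.
Proof.
move=> Msym; rewrite /bilin -[in LHS]Msym.
by rewrite -[in LHS](trmxK z) -!trmx_mul mulmxA [LHS]mxE.
Qed.

Lemma bilin_delta i j : bilin (delta_mx i 0) (delta_mx j 0) = M i j.
Proof. by rewrite /bilin trmx_delta -rowE -colE !mxE. Qed.

Lemma bilinE y z : bilin y z = \sum_i y i 0 * \sum_j M i j * z j 0.
Proof.
rewrite /bilin -mulmxA mxE; apply: eq_bigr => i _.
by rewrite !mxE.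
Qed.

End BilinearForm.

(** Expand the squares about the mean [c]: the cross term gives [-2c] and the constant term [c]. It
    serves for the vertex weights on a stable support and for the component masses. *)
Lemma sum_sqr_dev (R : numFieldType) (I : finType) (A : {set I}) (z : I -> R) :
  (0 < #|A|)%N -> \sum_(i in A) z i = 1 ->
  \sum_(i in A) z i ^+ 2 =
    #|A|%:R^-1 + \sum_(i in A) (z i - #|A|%:R^-1) ^+ 2.
Proof.
move=> A0 z1; set c := #|A|%:R^-1 : R.
have Ac : #|A|%:R * c = 1 by rewrite mulfV // pnatr_eq0 -lt0n.
have -> : \sum_(i in A) (z i - c) ^+ 2 =
    \sum_(i in A) z i ^+ 2 - c *+ 2 * \sum_(i in A) z i + \sum_(i in A) c ^+ 2.
  rewrite mulr_sumr -sumrB -big_split /=.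
  by apply: eq_bigr => i _; ring.
by rewrite z1 sumr_const -[_ *+ #|A|]mulr_natl expr2 mulrA Ac; ring.
Qed.

Lemma sum_indicator1 (R : pzSemiRingType) (I : finType) (i : I) :
  \sum_j (j == i)%:R = 1 :> R.
Proof.
by rewrite (bigD1 i) //= eqxx big1 ?addr0 // => j /negPf->.
Qed.

(** * Stable sets, cliques and connected components *)

Section Graph.
Variables (T : finType) (e : rel T).
Hypotheses (e_sym : symmetric e) (e_irr : irreflexive e).

Lemma stableP (A : {set T}) :
  reflect {in A &, forall i j, ~~ e i j} (stable_set e A).
Proof.
apply: (iffP forall_inP) => [h i j iA jA|h i iA].
  exact: (forall_inP (h i iA)).
by apply/forall_inP => j jA; apply: h.
Qed.

Lemma cliqueP (A : {set T}) :
  reflect {in A &, forall i j, i != j -> e i j} (clique e A).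
Proof.
apply: (iffP forall_inP) => [h i j iA jA|h i iA].
  exact/implyP/(forall_inP (h i iA)).
by apply/forall_inP => j jA; apply/implyP; apply: h.
Qed.

Lemma stability_number_ge (A : {set T}) :
  stable_set e A -> (#|A| <= stability_number e)%N.
Proof. exact: leq_bigmax_cond. Qed.

Lemma stability_number_attained :
  exists2 A, stable_set e A & #|A| = stability_number e.
Proof.
have st0 : stable_set e set0 by apply/stableP => i j; rewrite inE.
have [|A stA maxA] := @eq_bigmax_cond _ (stable_set e) (fun A : {set T} => #|A|).
  by apply/card_gt0P; exists set0.
by exists A.
Qed.

Variable S : {set T}.

Lemma induced_equiv :
  {in S & &, equivalence_rel (connect (induced e S))}.
Proof.
have csym : connect_sym (induced e S).
  by apply: sym_connect_sym => a b; rewrite /induced /= e_sym andbCA.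
move=> a b c _ _ _; split=> [|ab]; first exact: connect0.
exact: same_connect.
Qed.

Lemma components_partition : partition (components e S) S.
Proof. exact: equivalence_partitionP induced_equiv. Qed.

Lemma mem_pblock_components : {in S &, forall i j,
  (j \in pblock (components e S) i) = connect (induced e S) i j}.
Proof. exact: pblock_equivalence_partition induced_equiv. Qed.

(** An edge inside [S] joins vertices of one component, and a transversal meets each component only
    once. *)
Lemma components_transversal_stable :
  stable_set e (transversal (components e S) S).
Proof.
have P := components_partition.
have tP := transversalP P; have sub := transversal_sub tP.
apply/stableP => i j iX jX; apply/negP => eij.
have [iS jS] := (subsetP sub i iX, subsetP sub j jX).
suff ij : i = j by rewrite ij e_irr in eij.
apply: (pblock_inj tP) => //.
apply: same_pblock; first by case/and3P: P.
rewrite mem_pblock_components //; apply: connect1.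
by rewrite /induced /= iS jS e_sym.
Qed.

Lemma card_components_le : (#|components e S| <= stability_number e)%N.
Proof.
rewrite -(card_transversal (transversalP components_partition)).
exact/stability_number_ge/components_transversal_stable.
Qed.

(** Without induced paths on three vertices, adjacency in [S] is transitive up to equality, so by
    induction any path collapses to a single edge or to a point. *)
Lemma components_clique :
  {in S & &, forall i j l, e i j -> e j l -> i != l -> e i l} ->
  forall A, A \in components e S -> clique e A.
Proof.
move=> noP3 A AC; have P := components_partition.
have [/eqP covS tI _] := and3P P.
have AS i : i \in A -> i \in S.
  by move=> iA; rewrite -covS; apply/bigcupP; exists A.
have step p i : path (induced e S) i p -> (i == last i p) || e i (last i p).
  elim: p i => [|j p IH] i /=; first by rewrite eqxx.
  case/andP=> /and3P[iS jS eij] pth.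
  (* The end of a nonempty path lies in [S] because its last edge is an edge of the induced
     graph. *)
  have lS : last j p \in S.
    case: p pth {IH} => [|a p] //; rewrite lastI.
    by rewrite last_rcons rcons_path => /andP[_ /and3P[]].
  case: eqVneq => //= il.
  case/orP: (IH j pth) => [/eqP <- //|ejl].
  exact: noP3 ejl il.
apply/cliqueP => i j iA jA ij.
have : j \in pblock (components e S) i by rewrite (def_pblock tI AC iA).
rewrite mem_pblock_components ?AS // => /connectP[p /step + ej].
by rewrite -ej (negPf ij).
Qed.

End Graph.

(** * The form of [A_G + I] on the simplex *)

Section MotzkinStraus.
Variables (R : realType) (n : nat) (e : rel 'I_n).
Hypotheses (e_sym : symmetric e) (e_irr : irreflexive e).

Local Notation M := (adjacency R e + 1%:M).
Local Notation q := (quad_form M).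

Lemma adjacency1E i j : M i j = (e i j)%:R + (i == j)%:R.
Proof. by rewrite !mxE. Qed.

Lemma adjacency1_sym : M^T = M.
Proof. by apply/matrixP => i j; rewrite mxE !adjacency1E e_sym eq_sym. Qed.

Lemma quad_formE y : q y = bilin M y y.
Proof. by []. Qed.

Lemma quad_formD y z : q (y + z) = q y + 2 * bilin M z y + q z.
Proof.
rewrite !quad_formE bilinDl !bilinDr (bilinC y z adjacency1_sym).
by ring.
Qed.

Lemma quad_form_supp y :
  q y = \sum_(i in supp y) y i 0 * \sum_(j in supp y) M i j * y j 0.
Proof.
have E F : \sum_(i in supp y) F i * y i 0 = \sum_i F i * y i 0 :> R.
  rewrite [RHS](bigID (mem (supp y))) /= [X in _ + X]big1 ?addr0 // => i.
  by rewrite inE negbK => /eqP->; rewrite mulr0.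
rewrite quad_formE bilinE; under eq_bigr do rewrite mulrC -E.
by rewrite -E; apply: eq_bigr => i _; rewrite mulrC.
Qed.

Lemma sum_supp (y : 'cV[R]_n) : \sum_(i in supp y) y i 0 = \sum_i y i 0.
Proof.
rewrite [RHS](bigID (mem (supp y))) /= [X in _ + X]big1 ?addr0 // => i.
by rewrite inE negbK => /eqP.
Qed.

Lemma quad_form_stable y : stable_set e (supp y) ->
  q y = \sum_(i in supp y) y i 0 ^+ 2.
Proof.
move/stableP => st; rewrite quad_form_supp; apply: eq_bigr => i iS.
rewrite (bigD1 i) //= adjacency1E e_irr eqxx big1 => [|j /andP[jS ji]].
  by rewrite add0r mul1r addr0 expr2.
by rewrite adjacency1E eq_sym (negPf ji) (negPf (st _ _ iS jS)) addr0 mul0r.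
Qed.

Lemma simplex_supp_gt0 (y : 'cV[R]_n) : simplex y -> (0 < #|supp y|)%N.
Proof.
case=> _ y1; rewrite card_gt0; apply/eqP => S0.
by move: (oner_neq0 R); rewrite -y1 -sum_supp S0 big_set0 eqxx.
Qed.

Lemma stable_point A : stable_set e A -> (0 < #|A|)%N ->
  exists2 y : 'cV[R]_n, simplex y & q y = #|A|%:R^-1.
Proof.
move=> st A0; pose c : R := #|A|%:R^-1.
have c0 : c != 0 by rewrite invr_eq0 pnatr_eq0 -lt0n.
pose y : 'cV[R]_n := \col_i (if i \in A then c else 0).
have Sy : supp y = A.
  by apply/setP => i; rewrite inE mxE; case: ifP; rewrite ?c0 ?eqxx.
have yA i : i \in A -> y i 0 = c by rewrite mxE => ->.
exists y.
  split=> [i|]; first by rewrite mxE; case: ifP; rewrite ?invr_ge0 ?ler0n.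
  rewrite -sum_supp Sy (eq_bigr _ yA) sumr_const -mulr_natl mulfV //.
  by rewrite -invr_eq0.
rewrite quad_form_stable Sy // (eq_bigr (fun=> c ^+ 2)); last first.
  by move=> i iA; rewrite yA.
by rewrite sumr_const -[c ^+ 2 *+ _]mulr_natl expr2 mulrA mulfV ?mul1r // -invr_eq0.
Qed.

(* The form is affine along [e_i - e_j] for an edge [ij]. *)
Lemma shift_mass (y : 'cV[R]_n) i j : simplex y ->
  i \in supp y -> j \in supp y -> e i j ->
  bilin M (delta_mx i 0) y <= bilin M (delta_mx j 0) y ->
  exists z : 'cV[R]_n, [/\ simplex z, q z <= q y & supp z \proper supp y].
Proof.
move=> [y0 y1] iS jS eij le_ij.
have ij : i != j by apply: contraTneq eij => ->; rewrite e_irr.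
pose d : 'cV[R]_n := delta_mx i 0 + (-1) *: delta_mx j 0.
have dE a : d a 0 = (a == i)%:R - (a == j)%:R.
  by rewrite !mxE eqxx !andbT mulN1r.
(* The step length [y j 0] empties [j] exactly, so [j] leaves the support. *)
exists (y + y j 0 *: d); split.
- split=> [a|].
    rewrite !mxE eqxx !andbT; have := y0 a; have := y0 j.
    have [->|_] := eqVneq a i; first by rewrite (negPf ij) /=; lra.
    by have [->|_] := eqVneq a j; rewrite /=; lra.
  under eq_bigr do rewrite mxE [X in _ + X]mxE dE.
  rewrite big_split /= y1 -mulr_sumr sumrB.
  by rewrite !sum_indicator1 subrr mulr0 addr0.
- rewrite quad_formD bilinZl bilinDl bilinZl.
  (* Since [q d = 1 + 1 - 2], only the linear term survives, and [le_ij] makes it nonpositive. *)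
  have -> : q (y j 0 *: d) = 0.
    rewrite quad_formE bilinZl bilinZr !(bilinDl, bilinDr, bilinZl, bilinZr).
    rewrite !bilin_delta !adjacency1E !e_irr (e_sym j) eij !eqxx.
    rewrite (eq_sym j i) (negPf ij) /=; ring.
  by have := y0 j; nra.
- apply/properP; split.
    apply/subsetP => a; rewrite !inE !mxE eqxx !andbT; apply: contraNneq => a0.
    have [ai|_] := eqVneq a i; first by move: iS; rewrite inE -ai a0 eqxx.
    have [aj|_] := eqVneq a j; first by move: jS; rewrite inE -aj a0 eqxx.
    by rewrite a0 /= mulr0 addr0 mulr0 addr0.
  exists j; rewrite // inE negbK mxE [X in _ + X]mxE dE eqxx (eq_sym j i) (negPf ij).
  by apply/eqP; rewrite /=; ring.
Qed.

(** Induction on the size of the support. On a stable support the form is a sum of squares, at least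
    the inverse of the support size; otherwise an edge of the support allows a shift towards the end
    with the smaller [bilin] value. *)
Lemma Motzkin_Straus (y : 'cV[R]_n) : simplex y ->
  (stability_number e)%:R^-1 <= q y.
Proof.
have [m] := ubnP #|supp y|; elim: m y => // m IH y /ltnSE le_m ys.
have [st|] := boolP (stable_set e (supp y)).
  have S0 := simplex_supp_gt0 ys.
  rewrite quad_form_stable // sum_sqr_dev // ?sum_supp; last by case: ys.
  apply: (@le_trans _ _ #|supp y|%:R^-1); last first.
    by rewrite lerDl sumr_ge0 // => i _; exact: sqr_ge0.
  rewrite lef_pV2 ?posrE ?ltr0n // ?ler_nat ?stability_number_ge //.
  exact: leq_trans S0 (stability_number_ge st).
case/forall_inPn => i iS /forall_inPn[j jS]; rewrite negbK => eij.
have [z [zs qz /proper_card Sz]] : exists z : 'cV[R]_n,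
    [/\ simplex z, q z <= q y & supp z \proper supp y].
  have [le_ij|/ltW le_ji] :=
      leP (bilin M (delta_mx i 0) y) (bilin M (delta_mx j 0) y).
    exact: shift_mass le_ij.
  by apply: shift_mass le_ji; rewrite // e_sym.
by apply: le_trans qz; apply: IH => //; apply: leq_trans le_m.
Qed.

Lemma minimizer_P3_free x : global_minimizer (@simplex R n) q x ->
  {in supp x & &, forall i j l, e i j -> e j l -> i != l -> e i l}.
Proof.
move=> [[x0 x1] xmin] i j l iS jS lS eij ejl il; apply: contraT => neil.
have ij : i != j by apply: contraTneq eij => ->; rewrite e_irr.
have jl : j != l by apply: contraTneq ejl => ->; rewrite e_irr.
have gt0 a : a \in supp x -> 0 < x a 0 by rewrite inE lt_def x0 andbT => ->.
have [xi xj xl] : [/\ 0 < x i 0, 0 < x j 0 & 0 < x l 0] by split; apply: gt0.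
pose d : 'cV[R]_n := delta_mx i 0 + delta_mx l 0 + (-2) *: delta_mx j 0.
(* The diagonal gives [1 + 1 + 4], the edges [ij] and [jl] give [-4] each, and the non-edge [il]
   gives nothing. *)
have qd : q d = -2.
  rewrite quad_formE !(bilinDl, bilinDr, bilinZl, bilinZr) !bilin_delta.
  rewrite !adjacency1E !e_irr (e_sym j i) (e_sym l i) (e_sym l j).
  rewrite eij ejl (negPf neil) !eqxx.
  rewrite (eq_sym j i) (eq_sym l i) (eq_sym l j).
  by rewrite (negPf ij) (negPf jl) (negPf il) /=; ring.
have dE a : d a 0 = (a == i)%:R + (a == l)%:R - 2 * (a == j)%:R.
  by rewrite !mxE eqxx !andbT mulNr.
(* Half the least of the three weights keeps [x + t d] and [x - t d] both nonnegative. *)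
have [t [t0 ti tj tl]] : exists t : R,
    [/\ 0 < t, t <= x i 0, 2 * t <= x j 0 & t <= x l 0].
  exists (Num.min (x i 0) (Num.min (x j 0) (x l 0)) / 2).
  have m0 : 0 < Num.min (x i 0) (Num.min (x j 0) (x l 0)).
    by rewrite !lt_min xi xj xl.
  have := lexx (Num.min (x i 0) (Num.min (x j 0) (x l 0))).
  rewrite !le_min.
  move: (Num.min _ _) m0 => m m0 /and3P[mi mj ml].
  by split; lra.
have feas s : -t <= s -> s <= t -> simplex (x + s *: d).
  move=> s1 s2; split=> [a|].
    rewrite mxE [X in _ + X]mxE dE; have := x0 a.
    have [->|_] := eqVneq a i; first by rewrite (negPf ij) (negPf il) /=; lra.
    have [->|_] := eqVneq a l; first by rewrite eq_sym (negPf jl) /=; lra.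
    by have [->|_] := eqVneq a j; rewrite /=; lra.
  under eq_bigr do rewrite mxE [X in _ + X]mxE dE.
  rewrite big_split /= x1 -mulr_sumr sumrB -mulr_sumr big_split /=.
  by rewrite !sum_indicator1; ring.
have q1 := xmin _ (feas t _ _); have q2 := xmin _ (feas (- t) _ _).
have qZ s : q (s *: d) = -2 * s ^+ 2.
  by rewrite quad_formE bilinZl bilinZr -quad_formE qd; ring.
(* Adding the two inequalities cancels the linear terms and leaves [0 <= -4 t^2], which is
   absurd. *)
have := q1 ltac:(lra) ltac:(lra); have := q2 ltac:(lra) ltac:(lra).
rewrite !quad_formD !qZ !bilinZl; move: (bilin _ _ _) => b.
by nra.
Qed.

Lemma sum_components (x : 'cV[R]_n) : simplex x ->
  \sum_(A in components e (supp x)) \sum_(i in A) x i 0 = 1.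
Proof.
case=> _ <-; rewrite -sum_supp.
by rewrite -(set_partition_big _ (components_partition e_sym (supp x))).
Qed.

(** For [i] in a clique component, row [i] of [A_G + I] restricted to the support is the indicator
    of that component, so the inner sum is its mass. *)
Lemma quad_form_components x :
  (forall A, A \in components e (supp x) -> clique e A) ->
  q x = \sum_(A in components e (supp x)) (\sum_(i in A) x i 0) ^+ 2.
Proof.
move=> cl; have P := components_partition e_sym (supp x).
have [/eqP covS tI _] := and3P P.
rewrite quad_form_supp (set_partition_big _ P) /=; apply: eq_bigr => A AC.
rewrite expr2 mulr_suml; apply: eq_bigr => i iA; congr (_ * _).
have AS : A \subset supp x by rewrite -covS; apply: bigcup_sup.
rewrite [RHS]big_mkcond [RHS](bigID (mem (supp x))) /= [X in _ = _ + X]big1 ?addr0.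
  apply: eq_bigr => j jS; rewrite adjacency1E.
  case: ifPn => [jA|jA].
    have [->|ij] := eqVneq i j; first by rewrite e_irr add0r mul1r.
    by rewrite (cliqueP _ _ (cl A AC)) // addr0 mul1r.
  have [ij|_] := eqVneq i j; first by rewrite -ij iA in jA.
  rewrite addr0; case: (boolP (e i j)) => [eij|]; last by rewrite mul0r.
  have iS := subsetP AS i iA.
  (* An edge from [i] to [j] would put [j] in the component of [i]. *)
  move: jA; rewrite -(def_pblock tI AC iA) mem_pblock_components //.
  by rewrite connect1 // /induced /= iS jS.
by move=> j jS; case: ifP => // jA; rewrite (subsetP AS) in jS.
Qed.

Lemma card_components_gt0 (x : 'cV[R]_n) :
  simplex x -> (0 < #|components e (supp x)|)%N.
Proof.
move=> /sum_components s1; rewrite card_gt0; apply/eqP => C0.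
by move: (oner_neq0 R); rewrite -s1 C0 big_set0 eqxx.
Qed.

End MotzkinStraus.

(** * Characterization of the minimizers *)

Theorem corollary4p4 (R : realType) (n : nat) (e : rel 'I_n)
    (e_sym : symmetric e) (e_irr : irreflexive e)
    (x : 'cV[R]_n) (x_simplex : simplex x) :
  let C := components e (supp x) in
  let k := #|C| in
  global_minimizer (@simplex R n) (quad_form (adjacency R e + 1%:M)) x <->
  [/\ k = stability_number e,
      forall Ch : {set 'I_n}, Ch \in C -> clique e Ch
    & forall Ch : {set 'I_n}, Ch \in C -> \sum_(i in Ch) x i 0 = 1 / k%:R].
Proof.
move=> C k.
have k0 : (0 < k)%N := card_components_gt0 e_sym x_simplex.
have kle : (k <= stability_number e)%N := card_components_le e_sym e_irr _.
have a0 := leq_trans k0 kle.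
have qC (cl : forall A, A \in C -> clique e A) :=
  etrans (quad_form_components e_sym e_irr cl)
         (sum_sqr_dev k0 (sum_components e_sym x_simplex)).
split=> [xmin|[ka cl xC]].
- have cl := components_clique e_sym (minimizer_P3_free e_sym e_irr xmin).
  have [A stA cardA] := stability_number_attained e.
  have [|y ys qy] := stable_point R e_irr stA; first by rewrite cardA.
  (* Here [le_a] bounds [1/k] plus the squared deviations by [1/alpha]; as [k <= alpha], this forces
     [k = alpha] and then zero deviation. *)
  have := xmin.2 y ys; rewrite qy qC // cardA -/k => le_a.
  have dev0 : 0 <= \sum_(A in C) (\sum_(i in A) x i 0 - k%:R^-1) ^+ 2.
    by apply: sumr_ge0 => B _; exact: sqr_ge0.
  have ka : k = stability_number e.
    apply/eqP; rewrite eqn_leq kle -(ler_nat R) -lef_pV2 ?posrE ?ltr0n //.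
    by apply: le_trans le_a; rewrite lerDl.
  split=> // B BC; rewrite div1r; apply/eqP; rewrite -subr_eq0 -sqrf_eq0.
  have /psumr_eq0P sum0 : forall A, A \in C ->
      0 <= (\sum_(i in A) x i 0 - k%:R^-1) ^+ 2 by move=> *; exact: sqr_ge0.
  rewrite sum0 //; apply/eqP; rewrite eq_le dev0 andbT.
  by move: le_a; rewrite -ka gerDl.
(* Equal masses kill the deviations, so [x] attains the Motzkin-Straus bound. *)
- split=> // y ys; rewrite qC // big1 ?addr0.
    by rewrite -/k ka; exact: Motzkin_Straus.
  by move=> A AC; rewrite xC // div1r subrr expr0n.
Qed.
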